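(* For a deck $D$ of order $n$, the following are equivalent: 1. the number of cards of $D$ equals $\Delta_n=n^2-n+1$; 2. $D$ is $n$-symmetric; 3. $D$ is paired.
   Context: A deck consists of a finite set $S$ of symbols together with a finite collection $D$ of distinct cards, each card being a subset of $S$, satisfying: (D1) any two distinct cards have exactly one symbol in common; (D2) every symbol of $S$ lies on at least two cards; (D3) every card contains at least two symbols; (D4) all cards have the same cardinality $n$ (the order); (D5) $S$ is nonempty. A deck is $n$-symmetric if every symbol lies on exactly $n$ cards. A deck is paired if any two distinct symbols lie on exactly one card. *)

(* Defs.v *)
From mathcomp Require Import all_boot.

Set Implicit Arguments.
Unset Strict Implicit.
Unset Printing Implicit Defensive.

(* The finite set of symbols is (the full set of) a finType [S]; a collection
   of distinct cards is a set of subsets of [S]. *)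

Definition cards_at (S : finType) (D : {set {set S}}) (x : S) : {set {set S}} :=
  [set c in D | x \in c].

Record is_deck (S : finType) (D : {set {set S}}) (n : nat) : Prop := IsDeck {
  deck_meet : forall c d : {set S},
    c \in D -> d \in D -> c != d -> #|c :&: d| = 1;
  deck_symbol : forall x : S, 2 <= #|cards_at D x|;
  deck_card : forall c : {set S}, c \in D -> 2 <= #|c|;
  deck_order : forall c : {set S}, c \in D -> #|c| = n;
  deck_nonempty : 0 < #|S|
}.

Definition symmetric_deck (S : finType) (D : {set {set S}}) (n : nat) : Prop :=
  forall x : S, #|cards_at D x| = n.

Definition paired_deck (S : finType) (D : {set {set S}}) : Prop :=
  forall x y : S, x != y -> #|[set c in D | (x \in c) && (y \in c)]| = 1.

(* The subtraction is never truncated, since n <= n ^ 2. *)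
Definition Delta (n : nat) : nat := n ^ 2 - n + 1.

(* Main.v *)
Require Import Defs.
From mathcomp Require Import all_boot.

(** Double counting incidences between a card [c] and a family of cards gives
    two identities: the degrees of the symbols of [c] add up to [#|D| - 1 + n],
    and, when [c] misses [x], the degree of [x] is the sum over [y] in [c] of
    the number of cards through [x] and [y].  These last numbers are at most
    one, so every degree is at most [n], and the three conditions are the
    equality cases of the resulting bounds. *)

(** Both sides count the pairs [(d, y)] with [d] in [E] and [y] in [c :&: d]. The family [E] is
    arbitrary because both [D] and [cards_at D x] are needed. *)
Lemma sum_card_setI (S : finType) (E : {set {set S}}) (c : {set S}) :
  \sum_(d in E) #|c :&: d| = \sum_(y in c) #|cards_at E y|.
Proof.
transitivity (\sum_(d in E) \sum_(y in c | y \in d) 1).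
  by apply: eq_bigr => d _; rewrite -sum1_card; apply: eq_bigl => y; rewrite inE.
rewrite (exchange_big_dep (mem c)) /=; last by move=> d y _ /andP[].
apply: eq_bigr => y yc; rewrite -sum1_card; apply: eq_bigl => d.
by rewrite inE yc.
Qed.

Lemma cards_at_cards_at (S : finType) (D : {set {set S}}) (x y : S) :
  cards_at (cards_at D x) y = [set c in D | (x \in c) && (y \in c)].
Proof. by apply/setP=> c; rewrite !inE andbA. Qed.

Lemma sum_eq_maxP (T : finType) (A : {set T}) (f : T -> nat) (m : nat) :
    (forall x, x \in A -> f x <= m) ->
  reflect (forall x, x \in A -> f x = m) (\sum_(x in A) f x == #|A| * m).
Proof.
move=> f_le; rewrite -sum_nat_const.
have [_ ->] := leqif_sum (fun x xA => leqif_eq (f_le x xA)).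
exact: 'forall_in_eqP.
Qed.

(** Removes the subtraction, to match the shape of [sum_degrees]. *)
Lemma eq_Delta (b n : nat) : (b == Delta n) = (b + n == n * n + 1).
Proof.
have nn : n <= n ^ 2 by case: n => // n; rewrite leq_pmulr.
by rewrite /Delta -(eqn_add2r n b) addnAC subnK // mulnn.
Qed.

Section Deck.

Context {S : finType} {D : {set {set S}}} {n : nat} (deckD : is_deck D n).

(** Two distinct cards through [x] and [y] would share two symbols. *)
Lemma card_cards_at2_le1 (x y : S) :
  x != y -> #|cards_at (cards_at D x) y| <= 1.
Proof.
move=> xy; apply/card_le1_eqP => c d.
rewrite !inE => /andP[/andP[cD xc] yc] /andP[/andP[dD xd] yd].
apply/eqP; apply: contraNT xy => cd.
have /eqP/cards1P[z zE] := deck_meet deckD dD cD cd.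
have xz : x \in d :&: c by rewrite inE xd.
have yz : y \in d :&: c by rewrite inE yd.
by move: xz yz; rewrite zE !inE => /eqP-> /eqP->.
Qed.

Lemma card_through (x : S) : exists2 c, c \in D & x \in c.
Proof.
have /card_gt0P[c] := ltnW (deck_symbol deckD x).
by rewrite inE => /andP[cD xc]; exists c.
Qed.

(* If all cards passed through [x], a second symbol of any of them would share
   its (at least two) cards with [x]. *)
Lemma card_avoiding (x : S) : exists2 c, c \in D & x \notin c.
Proof.
case: (pickP [pred c in D | x \notin c]) => [c /andP[]|allx]; first by exists c.
have [c cD xc] := card_through x.
have /card_gt0P[y] : 0 < #|c :\ x|.
  by have := deck_card deckD cD; rewrite (cardsD1 x c) xc.
rewrite !inE => /andP[yx _].
have : #|cards_at (cards_at D x) y| <= 1.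
  by apply: card_cards_at2_le1; rewrite eq_sym.
rewrite leqNgt; case/negP; apply: leq_trans (deck_symbol deckD y) _.
apply/subset_leq_card/subsetP => d; rewrite !inE => /andP[dD ->].
by have := allx d; rewrite /= dD /= => /negbFE->.
Qed.

(** The card [c] meets itself in [n] symbols and every other card in one. *)
Lemma sum_degrees (c : {set S}) :
  c \in D -> \sum_(y in c) #|cards_at D y| + 1 = #|D| + n.
Proof.
move=> cD; rewrite -sum_card_setI (bigD1 c) //= setIid (deck_order deckD cD).
rewrite (eq_bigr (fun=> 1)); last first.
  by move=> d /andP[dD dc]; rewrite (deck_meet deckD) // eq_sym.
have := sum1_card (mem D); rewrite (bigD1 c) //= => <-.
by rewrite addn1 add1n addSn addnC.
Qed.

(** A card through [x] differs from [c], so it meets [c] in exactly one symbol [y]; the cards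
    through [x] are sorted by this [y]. *)
Lemma degree_eq_sum (x : S) (c : {set S}) :
    c \in D -> x \notin c ->
  #|cards_at D x| = \sum_(y in c) #|cards_at (cards_at D x) y|.
Proof.
move=> cD xc; rewrite -sum_card_setI -sum1_card; apply: eq_bigr => d.
rewrite inE => /andP[dD xd]; rewrite (deck_meet deckD) //.
by apply: contraNneq xc => ->.
Qed.

Lemma cards_at2_le1_in {x : S} {c : {set S}} :
  x \notin c -> forall y, y \in c -> #|cards_at (cards_at D x) y| <= 1.
Proof.
by move=> xc y yc; apply: card_cards_at2_le1; apply: contraNneq xc => ->.
Qed.

Lemma degree_le (x : S) : #|cards_at D x| <= n.
Proof.
have [c cD xc] := card_avoiding x.
rewrite (degree_eq_sum _ _ cD xc) -(deck_order deckD cD) -sum1_card.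
exact: leq_sum (cards_at2_le1_in xc).
Qed.

Lemma degree_eqP (x : S) (c : {set S}) :
    c \in D -> x \notin c ->
  reflect (forall y, y \in c -> #|cards_at (cards_at D x) y| = 1)
          (#|cards_at D x| == n).
Proof.
move=> cD xc; rewrite (degree_eq_sum _ _ cD xc) -(deck_order deckD cD).
by rewrite -[X in _ == X]muln1; apply: sum_eq_maxP; apply: cards_at2_le1_in.
Qed.

(** By [sum_degrees], the left side says that the [n] degrees along [c] add up to [n * n], the
    largest value that [degree_le] allows. *)
Lemma card_deck_eq_Delta (c : {set S}) :
    c \in D ->
  #|D| = Delta n <-> (forall y, y \in c -> #|cards_at D y| = n).
Proof.
move=> cD; apply: iff_trans (rwP eqP) _.
rewrite eq_Delta -(sum_degrees _ cD) eqn_add2r.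
rewrite -{1}(deck_order deckD cD); apply: iff_sym; apply: rwP.
by apply: sum_eq_maxP => y _; apply: degree_le.
Qed.

End Deck.

Theorem mainTheorem17 (S : finType) (D : {set {set S}}) (n : nat)
    (deckD : is_deck D n) :
  (#|D| = Delta n <-> symmetric_deck D n) /\
  (symmetric_deck D n <-> paired_deck D).
Proof.
split; split.
(* The criterion only controls symbols of [c], so [c] is taken through [x]. *)
- move=> eD x; have [c cD xc] := card_through deckD x.
  exact: (iffLR (card_deck_eq_Delta deckD _ cD) eD).
- move=> symD; have /card_gt0P[x _] := deck_nonempty deckD.
  have [c cD _] := card_through deckD x.
  by apply/(card_deck_eq_Delta deckD _ cD) => y _; apply: symD.
- move=> symD x y xy; rewrite -cards_at_cards_at.
  have [c cD yc] := card_through deckD y.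
  (* If [c] misses [x], the equality case of the degree bound applies to [y] in [c]; otherwise [c]
     itself is the card sought. *)
  have [xc|xc] := boolP (x \in c); last first.
    by apply: (elimT (degree_eqP deckD _ _ cD xc)) yc; apply/eqP/symD.
  apply/eqP; rewrite eqn_leq (card_cards_at2_le1 deckD) //=.
  by apply/card_gt0P; exists c; rewrite !inE cD xc.
- move=> pairD x; have [c cD xc] := card_avoiding deckD x.
  apply/eqP/(degree_eqP deckD _ _ cD xc) => y yc.
  by rewrite cards_at_cards_at pairD //; apply: contraNneq xc => ->.
Qed.
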